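(* Let $\mathcal{A}=\left(\frac{-7,-13}{\mathbb{Q}}\right)$ and let $\mathcal{H}_{7,13}=\mathbb{Z}\left[1,\,\tfrac12(1+i),\,\tfrac17(i+k),\,\tfrac1{14}(7+i+7j+k)\right]$ (the $\mathbb{Z}$-module with this basis, a maximal order of discriminant $13$). Then $\mathcal{H}_{7,13}$ is a principal ideal domain: every left ideal and every right ideal of $\mathcal{H}_{7,13}$ is principal.
   Context: $\mathcal{A}$ has $\mathbb{Q}$-basis $1,i,j,k$ with $i^2=-7$, $j^2=-13$, $k=ij=-ji$. *)

(* Defs.v *)
From HB Require Import structures.
From mathcomp Require Import all_boot all_order all_algebra ring lra.
Set Implicit Arguments.
Unset Strict Implicit.
Unset Printing Implicit Defensive.
Import GRing.Theory.
Local Open Scope ring_scope.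

(* The quaternion algebra (a, b / F): F-basis 1, i, j, k with i^2 = a,        *)
(* j^2 = b and k = i j = - j i; hence k^2 = - a b, i k = a j = - k i and      *)
(* k j = b i = - j k.                                                         *)
Record quat (F : fieldType) (a b : F) : Type :=
  Quat { quat0 : F; quat1 : F; quat2 : F; quat3 : F }.

Section QuaternionAlgebra.
Variables (F : fieldType) (a b : F).
Local Notation Q := (quat a b).
Implicit Types (x y z : Q) (c d : F).

Definition quat_tuple x := ((quat0 x, quat1 x), (quat2 x, quat3 x)).
Definition tuple_quat (t : (F * F) * (F * F)) : Q :=
  Quat a b t.1.1 t.1.2 t.2.1 t.2.2.
Lemma quat_tupleK : cancel quat_tuple tuple_quat. Proof. by case. Qed.
HB.instance Definition _ := Choice.copy (quat a b) (can_type quat_tupleK).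

Lemma quatP x y : quat0 x = quat0 y -> quat1 x = quat1 y ->
  quat2 x = quat2 y -> quat3 x = quat3 y -> x = y.
Proof. by case: x y => [? ? ? ?] [? ? ? ?] /= -> -> -> ->. Qed.

Definition addq x y : Q := Quat a b
  (quat0 x + quat0 y) (quat1 x + quat1 y)
  (quat2 x + quat2 y) (quat3 x + quat3 y).
Definition oppq x : Q :=
  Quat a b (- quat0 x) (- quat1 x) (- quat2 x) (- quat3 x).
Definition mulq x y : Q := Quat a b
  (quat0 x * quat0 y + a * quat1 x * quat1 y
     + b * quat2 x * quat2 y - a * b * quat3 x * quat3 y)
  (quat0 x * quat1 y + quat1 x * quat0 y
     - b * quat2 x * quat3 y + b * quat3 x * quat2 y)
  (quat0 x * quat2 y + quat2 x * quat0 y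
     + a * quat1 x * quat3 y - a * quat3 x * quat1 y)
  (quat0 x * quat3 y + quat3 x * quat0 y
     + quat1 x * quat2 y - quat2 x * quat1 y).
Definition scaleq c x : Q :=
  Quat a b (c * quat0 x) (c * quat1 x) (c * quat2 x) (c * quat3 x).

Fact addqA : associative addq.
Proof. by move=> x y z; apply: quatP => /=; ring. Qed.
Fact addqC : commutative addq.
Proof. by move=> x y; apply: quatP => /=; ring. Qed.
Fact add0q : left_id (Quat a b 0 0 0 0) addq.
Proof. by move=> x; apply: quatP => /=; ring. Qed.
Fact addNq : left_inverse (Quat a b 0 0 0 0) oppq addq.
Proof. by move=> x; apply: quatP => /=; ring. Qed.
HB.instance Definition _ :=
  GRing.isZmodule.Build (quat a b) addqA addqC add0q addNq.

Fact mulqA : associative mulq.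
Proof. by move=> x y z; apply: quatP => /=; ring. Qed.
Fact mul1q : left_id (Quat a b 1 0 0 0) mulq.
Proof. by move=> x; apply: quatP => /=; ring. Qed.
Fact mulq1 : right_id (Quat a b 1 0 0 0) mulq.
Proof. by move=> x; apply: quatP => /=; ring. Qed.
Fact mulqDl : left_distributive mulq +%R.
Proof. by move=> x y z; apply: quatP => /=; ring. Qed.
Fact mulqDr : right_distributive mulq +%R.
Proof. by move=> x y z; apply: quatP => /=; ring. Qed.
Fact oneq_neq0 : Quat a b 1 0 0 0 != 0.
Proof. by apply/eqP => -[] /eqP; rewrite oner_eq0. Qed.
HB.instance Definition _ := GRing.Zmodule_isNzRing.Build (quat a b)
  mulqA mul1q mulq1 mulqDl mulqDr oneq_neq0.

Fact scaleqA c d x : scaleq c (scaleq d x) = scaleq (c * d) x.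
Proof. by apply: quatP => /=; ring. Qed.
Fact scale1q : left_id 1 scaleq.
Proof. by move=> x; apply: quatP => /=; ring. Qed.
Fact scaleqDr : right_distributive scaleq +%R.
Proof. by move=> c x y; apply: quatP => /=; ring. Qed.
Fact scaleqDl x : {morph scaleq^~ x : c d / c + d}.
Proof. by move=> c d; apply: quatP => /=; ring. Qed.
HB.instance Definition _ := GRing.Zmodule_isLmodule.Build F (quat a b)
  scaleqA scale1q scaleqDr scaleqDl.

Fact scaleqAl c x y : c *: (x * y) = (c *: x) * y.
Proof. by apply: quatP => /=; ring. Qed.
HB.instance Definition _ := GRing.Lmodule_isLalgebra.Build F (quat a b) scaleqAl.
Fact scaleqAr c x y : c *: (x * y) = x * (c *: y).
Proof. by apply: quatP => /=; ring. Qed.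
HB.instance Definition _ := GRing.Lalgebra_isAlgebra.Build F (quat a b) scaleqAr.

Definition quat_row x : 'rV[F]_4 :=
  \row_i [:: quat0 x; quat1 x; quat2 x; quat3 x]`_i.
Definition row_quat (r : 'rV[F]_4) : Q :=
  Quat a b (r 0 (inord 0)) (r 0 (inord 1)) (r 0 (inord 2)) (r 0 (inord 3)).
Fact quat_vect_axiom : Vector.axiom 4 Q.
Proof.
exists quat_row => [c x y|].
  by apply/rowP => -[[|[|[|[|m]]]] lt_m4]; rewrite !mxE.
exists row_quat => [x|r].
  by apply: quatP; rewrite /= !mxE inordK.
apply/rowP => i; rewrite mxE; case: i => -[|[|[|[|m]]]] lt_m4 //=;
  by congr (r 0 _); apply/val_inj; rewrite /= inordK.
Qed.
HB.instance Definition _ :=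
  Lmodule_hasFinDim.Build F (quat a b) quat_vect_axiom.

Definition qI : Q := Quat a b 0 1 0 0.
Definition qJ : Q := Quat a b 0 0 1 0.
Definition qK : Q := Quat a b 0 0 0 1.

Lemma quatE x : x = quat0 x *: 1 + quat1 x *: qI + quat2 x *: qJ + quat3 x *: qK.
Proof. by apply: quatP => /=; ring. Qed.
Lemma qI_sqr : qI * qI = a%:A. Proof. by apply: quatP => /=; ring. Qed.
Lemma qJ_sqr : qJ * qJ = b%:A. Proof. by apply: quatP => /=; ring. Qed.
Lemma qIJ : qI * qJ = qK. Proof. by apply: quatP => /=; ring. Qed.
Lemma qJI : qJ * qI = - qK. Proof. by apply: quatP => /=; ring. Qed.

End QuaternionAlgebra.

Arguments qI {F a b}.
Arguments qJ {F a b}.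
Arguments qK {F a b}.

Notation A713 := (quat (- 7%:R : rat) (- 13%:R : rat)).

Definition H713_basis : 4.-tuple A713 :=
  [tuple 1;
         2%:R^-1 *: (1 + qI);
         7%:R^-1 *: (qI + qK);
         14%:R^-1 *: (7%:R + qI + 7%:R * qJ + qK)].

Lemma H713_basis_free : free H713_basis.
Proof.
apply/freeP => c; rewrite !big_ord_recl big_ord0 addr0 /=.
set c0 := c _; set c1 := c _; set c2 := c _; set c3 := c _ => -[].
rewrite !(mul0r, mul1r, mulr0, mulr1, add0r, addr0, oppr0, subr0).
move=> e0 e1 e2 e3.
have z3 : c3 = 0 by move: e2; lra.
have z2 : c2 = 0 by move: e3 z3; lra.
have z1 : c1 = 0 by move: e1 z2 z3; lra.
have z0 : c0 = 0 by move: e0 z1 z2 z3; lra.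
case=> -[|[|[|[|m]]]] lt_m4 //;
  [rewrite -z0|rewrite -z1|rewrite -z2|rewrite -z3];
  by congr (c _); apply/val_inj.
Qed.

Definition H713_pred : pred A713 := fun q => dec_Qint_span H713_basis q.

Lemma H713P (q : A713) : reflect (inIntSpan H713_basis q) (q \in H713_pred).
Proof. exact: sumboolP. Qed.

Definition H713_comb (x0 x1 x2 x3 : int) : A713 :=
  1 *~ x0 + (2%:R^-1 *: (1 + qI)) *~ x1 + (7%:R^-1 *: (qI + qK)) *~ x2
  + (14%:R^-1 *: (7%:R + qI + 7%:R * qJ + qK)) *~ x3.

Lemma H713_combP (q : A713) :
  reflect (exists x0 x1 x2 x3, q = H713_comb x0 x1 x2 x3) (q \in H713_pred).
Proof.
apply: (iffP (H713P q)) => [[c ->]|[x0 [x1 [x2 [x3 ->]]]]].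
  exists (c (inord 0)), (c (inord 1)), (c (inord 2)), (c (inord 3)).
  rewrite !big_ord_recl big_ord0 addr0 !addrA /=.
  by congr (_ *~ c _ + _ *~ c _ + _ *~ c _ + _ *~ c _);
    apply/val_inj; rewrite /= inordK.
exists [ffun i : 'I_4 => [:: x0; x1; x2; x3]`_i].
by rewrite !big_ord_recl big_ord0 addr0 !addrA !ffunE.
Qed.

Lemma H713_combE x0 x1 x2 x3 : H713_comb x0 x1 x2 x3 =
  Quat (- 7%:R) (- 13%:R)
    (x0%:~R + x1%:~R / 2%:R + x3%:~R / 2%:R)
    (x1%:~R / 2%:R + x2%:~R / 7%:R + x3%:~R / 14%:R)
    (x3%:~R / 2%:R)
    (x2%:~R / 7%:R + x3%:~R / 14%:R).
Proof.
rewrite /H713_comb -!(scaler_int (R := rat)).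
by apply: quatP => /=; field.
Qed.

Fact H713_subring : subring_closed H713_pred.
Proof.
split.
- by apply/H713_combP; exists 1, 0, 0, 0; rewrite H713_combE; apply: quatP => /=; field.
- move=> _ _ /H713_combP[x0 [x1 [x2 [x3 ->]]]] /H713_combP[y0 [y1 [y2 [y3 ->]]]].
  apply/H713_combP; exists (x0 - y0), (x1 - y1), (x2 - y2), (x3 - y3).
  by rewrite !H713_combE; apply: quatP => /=; field.
move=> _ _ /H713_combP[x0 [x1 [x2 [x3 ->]]]] /H713_combP[y0 [y1 [y2 [y3 ->]]]].
apply/H713_combP.
exists (x0 * y0 - 2 * (x1 * y1) - x2 * y1 - 2 * (x2 * y2) - x3 * y1
          - 2 * (x3 * y2) - 4 * (x3 * y3)),
       (x0 * y1 + x1 * y0 + x1 * y1 - 2 * (x2 * y3) + x3 * y1 + 2 * (x3 * y2)),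
       (x0 * y2 + x1 * y2 + 2 * (x1 * y3) + x2 * y0 + x2 * y3 - 2 * (x3 * y1)),
       (x0 * y3 - x1 * y2 + x2 * y1 + x3 * y0 + x3 * y1 + x3 * y3).
by rewrite !H713_combE; apply: quatP => /=; field.
Qed.
HB.instance Definition _ :=
  GRing.isSubringClosed.Build A713 H713_pred H713_subring.

Record H713 : Type := MkH713 { H713_val :> A713; _ : H713_val \in H713_pred }.
HB.instance Definition _ := [isSub for H713_val].
HB.instance Definition _ := [Choice of H713 by <:].
HB.instance Definition _ := [SubChoice_isSubNzRing of H713 by <:].

Section Ideals.
Variable R : nzRingType.

Definition left_ideal (I : R -> Prop) : Prop :=
  [/\ I 0, forall x y, I x -> I y -> I (x - y) & forall r x, I x -> I (r * x)].
Definition right_ideal (I : R -> Prop) : Prop :=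
  [/\ I 0, forall x y, I x -> I y -> I (x - y) & forall r x, I x -> I (x * r)].

Definition principal_left (I : R -> Prop) : Prop :=
  exists g, forall x, I x <-> exists r, x = r * g.
Definition principal_right (I : R -> Prop) : Prop :=
  exists g, forall x, I x <-> exists r, x = g * r.

(* Not assumed commutative. *)
Definition principal_ideal_domain : Prop :=
  [/\ forall x y : R, x * y = 0 -> x = 0 \/ y = 0,
      forall I, left_ideal I -> principal_left I
    & forall I, right_ideal I -> principal_right I].
End Ideals.

(* Main.v *)
(** The order [H] is not norm-Euclidean, but it satisfies the Dedekind-Hasse
    criterion: for every [xi] outside [H] there are [gamma], [delta] in [H] with
    [0 < N(gamma xi - delta) < 1], so a nonzero element of least norm generates a
    left ideal; conjugation handles right ideals.

    Let [K = Q(sqrt -7) = Q(i)]. Then [H = O_K + (1/i) O_K (1 + j)], and for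
    [xi = u + v j] and [w = i v] one has [N(xi) = |u|^2 + (13/7) |w|^2]. Modulo
    [O_K] every [u] can be brought to norm at most [4/7], hence it suffices to find
    [gamma] in [O_K] such that [gamma w] has distance squared less than [3/13]
    from [O_K]; elements of norm 1, 2 or 4 are enough. If [gamma xi - delta]
    vanishes, then [4 xi] lies in [H], and [xi] or [2 xi] is a nonzero class of
    [(1/2)H / H], where the 15 possibilities are checked one by one. *)
Require Import Defs.
From HB Require Import structures.
From mathcomp Require Import all_boot all_order all_algebra.
From mathcomp Require Import ring lra zify.
From Stdlib Require Import Classical.
Set Implicit Arguments.
Unset Strict Implicit.
Unset Printing Implicit Defensive.
Import Order.TTheory GRing.Theory Num.Theory.
Local Open Scope ring_scope.

(** * Conjugation and the reduced norm *)

Section QuaternionNorm.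
Variables (F : fieldType) (a b : F).
Implicit Types (x y : quat a b) (c : F).

Definition conjq x : quat a b :=
  Quat a b (quat0 x) (- quat1 x) (- quat2 x) (- quat3 x).
Definition normq x : F :=
  quat0 x ^+ 2 - a * quat1 x ^+ 2 - b * quat2 x ^+ 2 + a * b * quat3 x ^+ 2.

Lemma conjqK : involutive conjq.
Proof. by move=> x; apply: quatP => /=; ring. Qed.

Lemma conjqB x y : conjq (x - y) = conjq x - conjq y.
Proof. by apply: quatP => /=; ring. Qed.

Lemma conjqM x y : conjq (x * y) = conjq y * conjq x.
Proof. by apply: quatP => /=; ring. Qed.

Lemma mul_conjq x : conjq x * x = (normq x)%:A.
Proof. by apply: quatP; rewrite /normq /=; ring. Qed.

Lemma normqM x y : normq (x * y) = normq x * normq y.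
Proof. by rewrite /normq /=; ring. Qed.

End QuaternionNorm.

Lemma normqE (x : A713) : normq x =
  quat0 x ^+ 2 + 7%:R * quat1 x ^+ 2 + 13%:R * quat2 x ^+ 2 + 91%:R * quat3 x ^+ 2.
Proof. by rewrite /normq; ring. Qed.

Lemma normq_ge0 (x : A713) : 0 <= normq x.
Proof. by rewrite normqE; nra. Qed.

Lemma normq_eq0 (x : A713) : normq x = 0 -> x = 0.
Proof.
rewrite normqE => Nx0.
have h0 := sqr_ge0 (quat0 x); have h1 := sqr_ge0 (quat1 x).
have h2 := sqr_ge0 (quat2 x); have h3 := sqr_ge0 (quat3 x).
by apply: quatP => /=; apply/eqP; rewrite -sqrf_eq0; apply/eqP; lra.
Qed.

Lemma H713_comb_in x0 x1 x2 x3 : H713_comb x0 x1 x2 x3 \in H713_pred.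
Proof. by apply/H713_combP; exists x0, x1, x2, x3. Qed.

Lemma conjq_H713 (x : A713) : x \in H713_pred -> conjq x \in H713_pred.
Proof.
case/H713_combP=> x0 [x1 [x2 [x3 ->]]]; apply/H713_combP.
(* The conjugate is trace minus [x]; the basis elements have traces 2, 1, 0, 1. *)
exists (x0 + x1 + x3), (- x1), (- x2), (- x3).
by rewrite !H713_combE; apply: quatP => /=; field.
Qed.

Lemma normq_H713 (x : A713) : x \in H713_pred -> exists n : nat, normq x = n%:R.
Proof.
move=> Hx; have := normq_ge0 x.
case/H713_combP: Hx => x0 [x1 [x2 [x3 ->]]].
have -> : normq (H713_comb x0 x1 x2 x3) =
  (x0 ^+ 2 + 2 * x1 ^+ 2 + 2 * x2 ^+ 2 + 4 * x3 ^+ 2 + x0 * x1 + x0 * x3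
   + x1 * x2 + x1 * x3 + 2 * (x2 * x3))%:~R.
  by rewrite H713_combE normqE /=; field.
by rewrite ler0z; case: (_ + _ : int) => n // _; exists n.
Qed.

(** * Approximation by integers of [Q(sqrt -7)] *)

Lemma round_rat (a : rat) : exists m : int, `|a - m%:~R| <= 2%:R^-1.
Proof.
exists (Num.floor (a + 2%:R^-1)).
have := floor_le (a + 2%:R^-1); have := floorD1_gt (a + 2%:R^-1).
by rewrite rmorphD /= ler_norml => *; apply/andP; split; lra.
Qed.

(* Points of [Q(sqrt -7)] are pairs [(a, b)] standing for [a + b sqrt(-7)], and *)
(* the ring of integers is the set of pairs [(m + n/2, n/2)].                   *)
Lemma reduce_OK (a b : rat) : exists m n : int,
  `|a - m%:~R - n%:~R / 2%:R| <= 2%:R^-1 /\ `|b - n%:~R / 2%:R| <= 4%:R^-1.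
Proof.
have [n hn] := round_rat (2%:R * b).
have [m hm] := round_rat (a - n%:~R / 2%:R).
exists m, n; move: hn hm; rewrite !ler_norml => /andP[? ?] /andP[? ?].
by split; apply/andP; split; lra.
Qed.

Lemma OK_covering (a b : rat) : exists m n : int,
  (a - m%:~R - n%:~R / 2%:R) ^+ 2 + 7%:R * (b - n%:~R / 2%:R) ^+ 2
    <= 4%:R / 7%:R.
Proof.
have quadrant (c d : rat) : 0 <= c -> c <= 2%:R^-1 -> 0 <= d -> d <= 4%:R^-1 ->
    c ^+ 2 + 7%:R * d ^+ 2 <= 4%:R / 7%:R \/
    (c - 2%:R^-1) ^+ 2 + 7%:R * (d - 2%:R^-1) ^+ 2 <= 4%:R / 7%:R.
  move=> c0 c1 d0 d1.
  (* The line [c + 7 d = 2] is equidistant from 0 and [(1 + sqrt -7)/2]; the bound 4/7 is attained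
     on it at [(1/2, 3/14)]. *)
  have [h|/ltW h] := leP (c + 7%:R * d) 2%:R; [left|right]; nra.
have [m [n []]] := reduce_OK a b.
set c := a - _ - _; set d := b - _; rewrite !ler_norml => /andP[? ?] /andP[? ?].
have shift (k l : int) :
    (c - k%:~R - l%:~R / 2%:R) ^+ 2 + 7%:R * (d - l%:~R / 2%:R) ^+ 2
      <= 4%:R / 7%:R ->
    exists m n : int,
    (a - m%:~R - n%:~R / 2%:R) ^+ 2 + 7%:R * (b - n%:~R / 2%:R) ^+ 2
      <= 4%:R / 7%:R.
  move=> h; exists (m + k), (n + l); apply: le_trans h.
  by rewrite /c /d !rmorphD /= le_eqVlt; apply/orP; left; apply/eqP; field.
have [c0|/ltW c0] := leP 0 c; have [d0|/ltW d0] := leP 0 d.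
- have [|||||] := quadrant c d; try lra.
    by move=> h; apply: (shift 0 0); lra.
  by move=> h; apply: (shift 0 1); lra.
- have [|||||] := quadrant c (- d); try lra.
    by move=> h; apply: (shift 0 0); lra.
  by move=> h; apply: (shift 1 (-1)); lra.
- have [|||||] := quadrant (- c) d; try lra.
    by move=> h; apply: (shift 0 0); lra.
  by move=> h; apply: (shift (-1) 1); lra.
- have [|||||] := quadrant (- c) (- d); try lra.
    by move=> h; apply: (shift 0 0); lra.
  by move=> h; apply: (shift 0 (-1)); lra.
Qed.

(* [(p, q)] and [(m, n)] encode [gamma] and [beta] in [O_K] such that         *)
(* [gamma w - beta] has norm less than [3/13], where [w = (a, b)].            *)
Definition OK_approx (a b : rat) (p q m n : int) : Prop :=
  let c := p%:~R + q%:~R / 2%:R in let d := q%:~R / 2%:R in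
  (c * a - 7%:R * d * b - m%:~R - n%:~R / 2%:R) ^+ 2
    + 7%:R * (c * b + d * a - n%:~R / 2%:R) ^+ 2 < 3%:R / 13%:R.

(** The quadratic form is the norm of gamma; its allowed values divide 4. *)
Definition OK_approximable (a b : rat) : Prop := exists p q m n : int,
  p ^+ 2 + p * q + 2 * q ^+ 2 \in [:: 1; 2; 4 : int] /\ OK_approx a b p q m n.

Lemma OK_approximable_opp a b : OK_approximable (- a) (- b) -> OK_approximable a b.
Proof.
case=> p [q [m [n [Npq h]]]]; exists p, q, (- m), (- n); split=> //.
by move: h; rewrite /OK_approx !rmorphN /=; congr (_ < _); field.
Qed.

Lemma OK_approximable_conj a b : OK_approximable a (- b) -> OK_approximable a b.
Proof.
case=> p [q [m [n [Npq h]]]]; exists (p + q), (- q), (m + n), (- n); split.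
  by rewrite (_ : _ + _ = p ^+ 2 + p * q + 2 * q ^+ 2) //; ring.
by move: h; rewrite /OK_approx !rmorphN !rmorphD /=; congr (_ < _); field.
Qed.

Lemma OK_approximable_shift a b (k l : int) :
  OK_approximable (a - k%:~R - l%:~R / 2%:R) (b - l%:~R / 2%:R) ->
  OK_approximable a b.
Proof.
case=> p [q [m [n [Npq h]]]].
(* Add [gamma (k + l omega)] to beta, where [omega = (1 + sqrt -7)/2] and [omega^2 = omega - 2]. *)
exists p, q, (m + p * k - 2 * (q * l)), (n + p * l + q * k + q * l); split=> //.
by move: h; rewrite /OK_approx !(rmorphD, rmorphN, rmorphM) /=; congr (_ < _); field.
Qed.

(* On a box, [t ^+ 2] is bounded by its chord on each coordinate, which makes *)
(* the estimate in each of the five boxes linear.                             *)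
Lemma OK_approximable_box (a b : rat) :
  0 <= a -> a <= 2%:R^-1 -> 0 <= b -> b <= 4%:R^-1 -> OK_approximable a b.
Proof.
have chord (s t r : rat) : s <= r -> r <= t -> r ^+ 2 <= (s + t) * r - s * t.
  by move=> *; nra.
move=> a0 a1 b0 b1.
(* In order, gamma is 1, 2, 1, [(3 - sqrt -7)/2], [(1 - sqrt -7)/2]; beta is 0 when gamma is 1, and
   1 otherwise. *)
have [b2|b2] := leP b 12%:R^-1.
  have [a2|/ltW a2] := leP a (5%:R / 12%:R).
    exists 1, 0, 0, 0; split=> //; rewrite /OK_approx.
    by have := chord _ _ _ a0 a2; have := chord _ _ _ b0 b2; lra.
  exists 2, 0, 1, 0; split=> //; rewrite /OK_approx.
  by have := chord _ _ _ a2 a1; have := chord _ _ _ b0 b2; nra.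
have {}b2 := ltW b2.
have [b3|/ltW b3] := leP b 6%:R^-1.
  have [a2|/ltW a2] := leP a 6%:R^-1.
    exists 1, 0, 0, 0; split=> //; rewrite /OK_approx.
    by have := chord _ _ _ a0 a2; have := chord _ _ _ b2 b3; lra.
  exists 2, (-1), 1, 0; split=> //; rewrite /OK_approx.
  by have := chord _ _ _ a2 a1; have := chord _ _ _ b2 b3; lra.
exists 1, (-1), 1, 0; split=> //; rewrite /OK_approx.
by have := chord _ _ _ a0 a1; have := chord _ _ _ b3 b1; lra.
Qed.

Lemma OK_approximableT (a b : rat) : OK_approximable a b.
Proof.
have [k [l []]] := reduce_OK a b; rewrite !ler_norml.
move=> hc hd; apply: (@OK_approximable_shift _ _ k l); move: hc hd.
move: (a - _ - _) (b - _) => c d /andP[? ?] /andP[? ?].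
have half (r s : rat) : - 2%:R^-1 <= r -> r <= 2%:R^-1 -> 0 <= s ->
    s <= 4%:R^-1 -> OK_approximable r s.
  move=> *; have [r0|/ltW r0] := leP 0 r; first exact: OK_approximable_box.
  apply: OK_approximable_opp; apply: OK_approximable_conj; rewrite opprK.
  by apply: OK_approximable_box; lra.
have [d0|/ltW d0] := leP 0 d; first exact: half.
by apply: OK_approximable_conj; apply: half; lra.
Qed.

(** * The Dedekind-Hasse criterion *)

Definition hasse_reducible (xi : A713) : Prop := exists gamma delta : A713,
  [/\ gamma \in H713_pred, delta \in H713_pred,
      0 < normq (gamma * xi - delta) & normq (gamma * xi - delta) < 1].

Lemma hasse_reducibleM (x xi : A713) :
  x \in H713_pred -> hasse_reducible (x * xi) -> hasse_reducible xi.
Proof.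
move=> Hx [g [d [Hg Hd]]]; rewrite mulrA => ? ?.
by exists (g * x), d; split=> //; apply: rpredM.
Qed.

Lemma hasse_reducibleB (x xi : A713) :
  x \in H713_pred -> hasse_reducible (xi - x) -> hasse_reducible xi.
Proof.
move=> Hx [g [d [Hg Hd]]]; rewrite mulrBr -addrA -opprD => ? ?.
by exists g, (g * x + d); split=> //; rewrite rpredD // rpredM.
Qed.

Lemma int_parity (x : int) : exists (y : int) (r : bool), x = 2 * y + r%:Z.
Proof.
exists (x %/ 2)%Z, (x %% 2 == 1)%Z.
have := divz_eq x 2; have := modz_ge0 x (isT : (2 : int) != 0).
have := ltz_pmod x (isT : (0 : int) < 2); lia.
Qed.

Lemma hasse_reducible_comb (g0 g1 g2 g3 d0 d1 d2 d3 : int) (xi : A713) :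
  let N := normq (H713_comb g0 g1 g2 g3 * xi - H713_comb d0 d1 d2 d3) in
  0 < N -> N < 1 -> hasse_reducible xi.
Proof.
by exists (H713_comb g0 g1 g2 g3), (H713_comb d0 d1 d2 d3); rewrite !H713_comb_in.
Qed.

Lemma hasse_reducible_half (xi : A713) :
  2%:R * xi \in H713_pred -> xi \notin H713_pred -> hasse_reducible xi.
Proof.
case/H713_combP=> x0 [x1 [x2 [x3]]].
have [y0 [r0 ->]] := int_parity x0; have [y1 [r1 ->]] := int_parity x1.
have [y2 [r2 ->]] := int_parity x2; have [y3 [r3 ->]] := int_parity x3.
move=> exi.
have {exi} exi : xi - H713_comb y0 y1 y2 y3 =
    (2%:R^-1 : rat) *: H713_comb r0 r1 r2 r3.
  have -> : xi = (2%:R^-1 : rat) *: (2%:R * xi) by apply: quatP => /=; field.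
  by rewrite exi !H713_combE; apply: quatP; rewrite /= !rmorphD !rmorphM /=; field.
move=> nxi; apply: (hasse_reducibleB (H713_comb_in y0 y1 y2 y3)).
have {nxi} nxi : xi - H713_comb y0 y1 y2 y3 \notin H713_pred.
  by apply: contra nxi => h; rewrite -(subrK (H713_comb y0 y1 y2 y3) xi) rpredD ?H713_comb_in.
move: nxi; rewrite exi {exi}.
case: r0; case: r1; case: r2; case: r3 => nxi.
(* Four coordinates of gamma, then four of delta, for each nonzero class; the last case is the zero
   class. *)
all: [> apply: (@hasse_reducible_comb 0 1 1 0 (-2) 0 2 0)
     | apply: (@hasse_reducible_comb 0 0 0 1 (-1) 1 (-1) 1)
     | apply: (@hasse_reducible_comb 1 0 1 0 0 0 1 1)
     | apply: (@hasse_reducible_comb 0 0 0 1 0 0 (-1) 1)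
     | apply: (@hasse_reducible_comb 1 1 0 0 0 1 2 0)
     | apply: (@hasse_reducible_comb 0 0 1 0 (-1) 0 0 0)
     | apply: (@hasse_reducible_comb 0 1 0 0 0 0 1 0)
     | apply: (@hasse_reducible_comb 0 0 1 0 0 0 0 0)
     | apply: (@hasse_reducible_comb 0 1 1 0 (-2) (-1) 2 0)
     | apply: (@hasse_reducible_comb 1 0 0 0 0 0 1 0)
     | apply: (@hasse_reducible_comb 0 0 0 1 (-2) 0 (-1) 1)
     | apply: (@hasse_reducible_comb 0 1 0 0 (-1) 0 0 0)
     | apply: (@hasse_reducible_comb 0 0 1 0 (-1) (-1) 0 0)
     | apply: (@hasse_reducible_comb 1 0 0 0 0 0 0 0)
     | apply: (@hasse_reducible_comb 0 0 1 0 0 (-1) 0 0)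
     | case/negP: nxi; rewrite (_ : _ *: _ = 0) ?rpred0 //;
       by rewrite H713_combE; apply: quatP => /=; field ].
all: by rewrite !H713_combE normqE /=; lra.
Qed.

Lemma hasse_reducible_notin (xi : A713) : xi \notin H713_pred -> hasse_reducible xi.
Proof.
move=> nxi.
(* With [xi = u + v j], the point below is [i v]. *)
have [p [q [m [n [Npq hw]]]]] :=
  OK_approximableT (- 7%:R * quat3 xi) (quat2 xi).
set g := H713_comb p q 0 0.
(* The last two coordinates of delta make its [j]-part [i^-1 beta]. They also move the [K]-part, so
   [k] and [l] are chosen after subtracting them. *)
pose u := g * xi - H713_comb 0 0 (- m - n) n.
have [k [l hu]] := OK_covering (quat0 u) (quat1 u).
set d := H713_comb k l (- m - n) n.
have Hg : g \in H713_pred by apply: H713_comb_in.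
have Hd : d \in H713_pred by apply: H713_comb_in.
(* [4/7 + (13/7)(3/13) = 1], and the second bound is strict. *)
have lt1 : normq (g * xi - d) < 1.
  move: hu hw; rewrite /OK_approx normqE /u /d /g !H713_combE /=.
  by rewrite !(rmorphD, rmorphN) /=; nra.
have [N0|] := eqVneq (normq (g * xi - d)) 0; last first.
  by move=> Nn0; exists g, d; split=> //; rewrite lt_def Nn0 normq_ge0.
have {N0} gxi : g * xi = d by apply/eqP; rewrite -subr_eq0; apply/eqP/normq_eq0.
(* [N(g) xi = conjq g * d] lies in the order, and [N(g)] divides 4. *)
have H4 : 4%:R * xi \in H713_pred.
  have Ng : normq g = (p ^+ 2 + p * q + 2 * q ^+ 2)%:~R.
    by rewrite /g H713_combE normqE /=; field.
  have : (normq g)%:A * xi \in H713_pred.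
    by rewrite -mul_conjq -mulrA gxi rpredM ?conjq_H713.
  rewrite Ng; move: Npq; rewrite !inE => /or3P[] /eqP -> h.
  - rewrite (_ : 4%:R * xi = 4%:R * (1%:~R%:A * xi)); first by rewrite rpredM ?rpred_nat.
    by apply: quatP => /=; ring.
  - rewrite (_ : 4%:R * xi = 2%:R * (2%:~R%:A * xi)); first by rewrite rpredM ?rpred_nat.
    by apply: quatP => /=; ring.
  - rewrite (_ : 4%:R * xi = 4%:~R%:A * xi); first exact: h.
    by apply: quatP => /=; ring.
have [H2|nH2] := boolP (2%:R * xi \in H713_pred).
  exact: hasse_reducible_half.
apply: (@hasse_reducibleM 2%:R); first exact: rpred_nat.
by apply: hasse_reducible_half => //; rewrite mulrA -natrM.
Qed.

(** * Generators of least norm *)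

(** Ideals are arbitrary predicates, so the least norm is found by excluded middle. *)
Lemma prop_ex_minn (P : nat -> Prop) : (exists n, P n) ->
  exists n, P n /\ forall k, P k -> (n <= k)%N.
Proof.
case=> n; elim/ltn_ind: n => n IHn Pn.
have [[k [Pk ltkn]]|nk] := classic (exists k, P k /\ (k < n)%N); first exact: IHn Pk.
exists n; split=> // k Pk; rewrite leqNgt; apply/negP => ltkn.
by apply: nk; exists k.
Qed.

Lemma H713_left_principal (I : H713 -> Prop) : left_ideal I -> principal_left I.
Proof.
case=> I0 IB IM.
have [[x [Ix xn0]]|nI] := classic (exists x, I x /\ x != 0); last first.
  exists 0 => x; split=> [Ix|[r ->]]; last by rewrite mulr0.
  exists 0; rewrite mulr0; apply/eqP/negP => /negP xn0.
  by apply: nI; exists x.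
pose P (n : nat) := exists x, [/\ I x, x != 0 & normq (val x) = n%:R].
have [n [[g [Ig gn0 Ng]] minn]] : exists n, P n /\ forall k, P k -> (n <= k)%N.
  by apply: prop_ex_minn; have [n Nx] := normq_H713 (valP x); exists n, x.
have Ngn0 : normq (val g) != 0.
  by apply: contra gn0 => /eqP/normq_eq0 h; apply/eqP/val_inj.
exists g => y; split=> [Iy|[r ->]]; last exact: IM.
(* This is [y g^-1]. *)
pose xi := (normq (val g))^-1 *: (val y * conjq (val g)).
have xig : xi * val g = val y.
  by rewrite /xi -scalerAl -mulrA mul_conjq -scalerAr mulr1 scalerA mulVf ?scale1r.
have [Hxi|nxi] := boolP (xi \in H713_pred).
  by exists (MkH713 Hxi); apply/val_inj; rewrite /= xig.
have [c [d [Hc Hd lt0 lt1]]] := hasse_reducible_notin nxi.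
(* [z = (c xi - d) g] is a nonzero element of [I] of norm below that of [g]. *)
pose z : H713 := MkH713 Hc * y - MkH713 Hd * g.
have Nz : normq (val z) = normq (c * xi - d) * normq (val g).
  by rewrite -normqM mulrBl -mulrA xig.
have [k Nk] := normq_H713 (valP z).
have : (n <= k)%N.
  apply: minn; exists z; split=> //; first by apply: IB; apply: IM.
  apply/eqP => z0; move: Nz; rewrite z0 /normq /= => /esym/eqP.
  by rewrite !(expr0n, mulr0, subr0, addr0) mulf_eq0 (negPf Ngn0) orbF gt_eqF.
rewrite -(ler_nat rat) -Nk -Ng Nz leNgt gtr_pMl ?lt1 //.
by rewrite lt_def Ngn0 normq_ge0.
Qed.

Definition conjH (x : H713) : H713 := MkH713 (conjq_H713 (valP x)).

Lemma conjHK : involutive conjH.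
Proof. by move=> x; apply/val_inj; rewrite /= conjqK. Qed.

Lemma conjHB x y : conjH (x - y) = conjH x - conjH y.
Proof. by apply/val_inj; rewrite /= conjqB. Qed.

Lemma conjHM x y : conjH (x * y) = conjH y * conjH x.
Proof. by apply/val_inj; rewrite /= conjqM. Qed.

Lemma H713_right_principal (I : H713 -> Prop) :
  right_ideal I -> principal_right I.
Proof.
case=> I0 IB IM.
have [|g gI] := @H713_left_principal (fun x => I (conjH x)).
  split=> [|x y Ix Iy|r x Ix].
  - by rewrite -(subrr 0) conjHB subrr.
  - by rewrite conjHB; apply: IB.
  - by rewrite conjHM; apply: IM.
exists (conjH g) => x; rewrite -{1}(conjHK x) gI.
split=> -[r xr]; exists (conjH r); first by rewrite -conjHM -xr conjHK.
by rewrite xr conjHM conjHK.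
Qed.

(** The norm is multiplicative and vanishes only at 0. *)
Lemma H713_integral (x y : H713) : x * y = 0 -> x = 0 \/ y = 0.
Proof.
move=> /(congr1 (fun z : H713 => normq (val z))).
rewrite /= normqM (_ : normq (0 : A713) = 0); last by rewrite /normq /=; ring.
move/eqP; rewrite mulf_eq0.
by case/orP=> /eqP/normq_eq0 h; [left|right]; apply/val_inj.
Qed.

Theorem theorem5p2 : principal_ideal_domain H713.
Proof.
split; [exact: H713_integral | exact: H713_left_principal
       | exact: H713_right_principal].
Qed.
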